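(* For every $\epsilon\in(0,1)$ there are constants $C_1,C_2>0$ such that for any dimension $n\ge1$, any nonempty set $A\subset\mathbb{F}_2^n$ and any $\lambda>0$ we have $$\sup_{j\in[\epsilon n,(1-\epsilon)n]}\frac{2^n\,(1_A*1_A,\,1_{\mathbb{S}_j})}{|\mathbb{S}_j|\,|A|}\ge\lambda\quad\Longrightarrow\quad|A|\ge C_1\lambda^{C_2}2^n ,$$ where the supremum is over integers $j$ in the indicated interval. In other words, for such $j$, $\mathbb{P}[X+Y\in A]\ge\lambda$ implies $|A|\ge C_1\lambda^{C_2}2^n$, where $(X,Y)$ is uniform on $A\times\mathbb{S}_j$.
   Context: $|x|$ is the Hamming weight (number of ones) of $x\in\mathbb{F}_2^n$ and $\mathbb{S}_j=\{x\in\mathbb{F}_2^n:|x|=j\}$. $1_B$ is the indicator function of a set $B\subset\mathbb{F}_2^n$. The inner product is $(f,g)=2^{-n}\sum_{x\in\mathbb{F}_2^n}f(x)\overline{g(x)}$, and the convolution is unnormalized: $f*g(x)=\sum_{y\in\mathbb{F}_2^n}f(x-y)g(y)$. If no integer lies in $[\epsilon n,(1-\epsilon)n]$, the hypothesis is regarded as not satisfied. *)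

(* Defs.v *)
From mathcomp Require Import all_boot all_order all_algebra.
From mathcomp Require Import all_classical all_reals all_analysis.

Set Implicit Arguments.
Unset Strict Implicit.
Unset Printing Implicit Defensive.

Import Order.TTheory GRing.Theory Num.Theory.

Local Open Scope ring_scope.

Notation cube n := 'rV['F_2]_n.

Definition hamming_weight (n : nat) (x : cube n) : nat :=
  #|[set i : 'I_n | x ord0 i == 1]%SET|.

Definition sphere (n j : nat) : {set cube n} :=
  [set x : cube n | hamming_weight x == j]%SET.

(* Real-valued, unlike the \1_A of the analysis library, and over a finset. *)
Definition indicator (R : realType) (n : nat) (B : {set cube n}) : cube n -> R :=
  fun x => (x \in B)%:R.

(* Complex conjugation of the second argument is dropped: the functions are
   real-valued. *)
Definition inner (R : realType) (n : nat) (f g : cube n -> R) : R :=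
  (2 ^+ n)^-1 * \sum_(x : cube n) f x * g x.

Definition convolution (R : realType) (n : nat) (f g : cube n -> R) :
    cube n -> R :=
  fun x => \sum_(y : cube n) f (x - y) * g y.

(* Natural numbers suffice for the integers of the interval, since it lies in
   the positive half-line when 0 < eps. *)
Definition levels (R : realType) (eps : R) (n : nat) : set nat :=
  [set j : nat | eps * n%:R <= j%:R <= (1 - eps) * n%:R]%classic.

Definition sphere_ratio (R : realType) (n : nat) (A : {set cube n}) (j : nat) : R :=
  2 ^+ n * inner (convolution (indicator R A) (indicator R A))
                 (indicator R (sphere n j))
  / (#|sphere n j|%:R * #|A|%:R).

(* Probability of the event E under the uniform distribution on Omega. *)
Definition finite_uniform_prob (R : realType) (T : finType) (Omega : {set T})
    (E : pred T) : R :=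
  #|[set w in Omega | E w]%SET|%:R / #|Omega|%:R.

(* Main.v *)
(* Expanding in characters, 2^n times the number of pairs of A whose sum lies in S_j
   is the sum over S of K_j(S) |Ahat(S)|^2.  Pairing the factors of
   (1 - X)^j (1 + X)^(n - j) into powers of 1 - X^2 and using the reciprocity of
   Krawtchouk polynomials, one finds that |K_j(S)| / |S_j| is at most
   2 (r^|S| + r^(n - |S|)) for some r < 1 depending only on eps; this removes the
   sqrt(n) that is lost when S_j is compared with a Bernoulli measure.  The two
   resulting sums are controlled by the noise operator, for which a two-point
   inequality tensorises to small-set expansion: the normalised energy of A is at
   most (|A| / 2^n)^(1 + d).  Hence the ratio is at most 4 (|A| / 2^n)^d. *)
Require Import Defs.
From mathcomp Require Import all_boot all_order all_algebra.
From mathcomp Require Import all_classical all_reals all_analysis.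
From mathcomp Require Import ring lra zify.

Set Implicit Arguments.
Unset Strict Implicit.
Unset Printing Implicit Defensive.

Import Order.TTheory GRing.Theory Num.Theory.

Local Open Scope ring_scope.

(** * The two-point inequality *)

(** Young's inequality for the product of x^d and 1, with conjugate exponents 1/d and 1/(1 - d). *)
Lemma powR_bernoulli (R : realType) (x d : R) :
  0 <= x -> 0 < d < 1 -> x `^ d <= 1 + d * (x - 1).
Proof.
move=> x0 /andP[d0 d1].
have h : (d^-1)^-1 + ((1 - d)^-1)^-1 = 1 :> R by rewrite !invrK; ring.
have := conjugate_powR (powR_ge0 x d) (@ler01 R) _ _ h.
rewrite !invr_gt0 subr_gt0 => /(_ d0 d1).
rewrite mulr1 -powRrM mulfV ?gt_eqF// powRr1// powR1 !invrK => /le_trans; apply.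
by lra.
Qed.

(** The case of [two_point_ineq2] in which both pairs coincide. Its terms are homogeneous of degree
    [1 + d] in [(x, y)], so only the relative difference of [x] and [y] matters, and Bernoulli's
    inequality reduces the claim to a quadratic in it. *)
Lemma two_point_ineq (R : realType) (r d x y : R) :
  0 <= r < 1 -> d = (1 - r) / 4 -> 0 <= x -> 0 <= y ->
  (1 + r) * (x `^ (1 + d) + y `^ (1 + d)) + 2 * (1 - r) * (x * y) `^ ((1 + d) / 2)
    <= 2 `^ (1 - d) * (x + y) `^ (1 + d).
Proof.
move=> /andP[r0 r1] dE x0 y0.
have d0 : 0 < d by lra.
have d1 : d < 1 by lra.
have [xy0|xy0] := eqVneq (x + y) 0.
  have -> : x = 0 by lra.
  have -> : y = 0 by lra.
  by rewrite mulr0 addr0 !powR0 ?addr0 ?mulr0 ?addr0 //; lra.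
(* Mean and relative difference: m^(1 + d) factors out of every term and leaves an inequality in [s]
   with -1 <= s <= 1. *)
pose m := (x + y) / 2; pose s := (x - y) / (x + y).
have m0 : 0 < m by rewrite /m divr_gt0// lt_def xy0 addr_ge0.
have xE : x = m * (1 + s) by rewrite /m /s; field.
have yE : y = m * (1 - s) by rewrite /m /s; field.
have s1 : 0 <= 1 + s by rewrite -(pmulr_rge0 _ m0) -xE.
have s2 : 0 <= 1 - s by rewrite -(pmulr_rge0 _ m0) -yE.
have powS (t : R) : 0 <= t -> t `^ (1 + d) <= t * (1 + d * (t - 1)).
  move=> t0; rewrite powRD; last by apply/implyP => /eqP; lra.
  by rewrite powRr1// ler_wpM2l// powR_bernoulli// d0.
have -> : (x * y) `^ ((1 + d) / 2) = m `^ (1 + d) * (1 - s ^+ 2) `^ ((1 + d) / 2).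
  have -> : x * y = m ^+ 2 * (1 - s ^+ 2) by rewrite xE yE; ring.
  rewrite powRM ?sqr_ge0//; last by rewrite (_ : _ - _ = (1 + s) * (1 - s)) ?mulr_ge0//; ring.
  rewrite -(@powR_mulrn _ m 2 (ltW m0)) -powRrM.
  by congr (m `^ _ * _); field.
have -> : 2 `^ (1 - d) * (x + y) `^ (1 + d) = m `^ (1 + d) * 4.
  have -> : x + y = 2 * m by rewrite /m; field.
  rewrite powRM ?(ltW m0)// mulrA -powRD; last by apply/implyP => /eqP; lra.
  rewrite (_ : 1 - d + (1 + d) = 2%:R); last by ring.
  by rewrite powR_mulrn// mulrC; congr (_ * _); ring.
have -> : x `^ (1 + d) = m `^ (1 + d) * (1 + s) `^ (1 + d).
  by rewrite xE powRM// ltW.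
have -> : y `^ (1 + d) = m `^ (1 + d) * (1 - s) `^ (1 + d).
  by rewrite yE powRM// ltW.
have hp := powS _ s1; have hm := powS _ s2.
have hb : (1 - s ^+ 2) `^ ((1 + d) / 2) <= 1 - (1 + d) / 2 * s ^+ 2.
  apply: le_trans (powR_bernoulli _ _) _; [|by lra|by lra].
  by rewrite (_ : _ - _ = (1 + s) * (1 - s)) ?mulr_ge0//; ring.
rewrite -mulrDr !mulrA ![_ * m `^ _]mulrC -!mulrA -mulrDr ler_wpM2l ?powR_ge0//.
apply: (@le_trans _ _ ((1 + r) * ((1 + s) * (1 + d * (1 + s - 1)) +
   (1 - s) * (1 + d * (1 - s - 1))) + 2 * ((1 - r) * (1 - (1 + d) / 2 * s ^+ 2)))).
  apply: lerD; first by rewrite ler_wpM2l ?lerD//; lra.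
  by rewrite ler_wpM2l// ler_wpM2l//; lra.
(* The constants cancel and only s^2 times a number remains. With d = (1 - r)/4 that number is (1 -
   r)((1 - r)/2 + d), which is nonnegative. *)
rewrite -subr_ge0.
rewrite (_ : 4 - _ = s ^+ 2 * ((1 - r) * (1 + d) - 2 * (1 + r) * d)); last by field.
by rewrite mulr_ge0 ?sqr_ge0// dE; nra.
Qed.

(* Cauchy-Schwarz for the positive semidefinite matrix with diagonal [1 + r] and
   off-diagonal [1 - r], whose quadratic form [two_point_ineq] bounds. *)
Lemma two_point_ineq2 (R : realType) (r d s a0 a1 b0 b1 : R) :
  0 <= r < 1 -> d = (1 - r) / 4 -> s = (1 + d) / 2 ->
  0 <= a0 -> 0 <= a1 -> 0 <= b0 -> 0 <= b1 ->
  (1 + r) * ((a0 * b0) `^ s + (a1 * b1) `^ s) +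
  (1 - r) * ((a0 * b1) `^ s + (a1 * b0) `^ s)
    <= 2 `^ (1 - d) * ((a0 + a1) * (b0 + b1)) `^ s.
Proof.
move=> r01 dE sE a00 a10 b00 b10.
have s2 (x : R) : (x `^ s) ^+ 2 = x `^ (1 + d).
  by rewrite -powR_mulrn ?powR_ge0// -powRrM sE; congr (_ `^ _); field.
have ha := two_point_ineq r01 dE a00 a10.
have hb := two_point_ineq r01 dE b00 b10.
move: ha hb; rewrite -!s2 -sE !powRM ?addr_ge0// => ha hb.
have := powR_ge0 a0 s; have := powR_ge0 a1 s.
have := powR_ge0 b0 s; have := powR_ge0 b1 s.
have := powR_ge0 (a0 + a1) s; have := powR_ge0 (b0 + b1) s.
have := powR_ge0 2 (1 - d).
move: (2 `^ (1 - d)) (a0 `^ s) (a1 `^ s) (b0 `^ s) (b1 `^ s) ((a0 + a1) `^ s)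
  ((b0 + b1) `^ s) ha hb.
move=> c u0 u1 v0 v1 m m' ha hb c0 m'0 m0 v10 v00 u10 u00.
case/andP: r01 => r0 r1.
rewrite -ler_sqr ?nnegrE; last first.
- by rewrite !mulr_ge0.
- by apply: addr_ge0; apply: mulr_ge0; (try lra); apply: addr_ge0; exact: mulr_ge0.
apply: (@le_trans _ _ (((1 + r) * (u0 ^+ 2 + u1 ^+ 2) + 2 * (1 - r) * (u0 * u1)) *
   ((1 + r) * (v0 ^+ 2 + v1 ^+ 2) + 2 * (1 - r) * (v0 * v1)))).
  (* Lagrange's identity: the gap is the determinant (1 + r)^2 - (1 - r)^2 = 4r of the form times
     the squared determinant of the two vectors. *)
  rewrite -subr_ge0.
  rewrite (_ : _ - ((1 + r) * (u0 * v0 + _) + _) ^+ 2 = 4 * r * (u0 * v1 - u1 * v0) ^+ 2); last by ring.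
  by rewrite mulr_ge0 ?sqr_ge0//; lra.
rewrite (_ : (c * (m * m')) ^+ 2 = (c * m ^+ 2) * (c * m' ^+ 2)); last by ring.
have form_ge0 u v : 0 <= u -> 0 <= v ->
    0 <= (1 + r) * (u ^+ 2 + v ^+ 2) + 2 * (1 - r) * (u * v).
  move=> u0' v0'; apply: addr_ge0; apply: mulr_ge0; [lra| |lra|exact: mulr_ge0].
  by rewrite addr_ge0// sqr_ge0.
by apply: ler_pM => //; exact: form_ge0.
Qed.

(** * Krawtchouk coefficients *)

(** The value K_k(a) of the Krawtchouk polynomial of degree [k] in dimension [a + b], read off its
    generating function. *)
Definition krawtchouk (R : nzRingType) (a b k : nat) : R :=
  ((1 - 'X) ^+ a * (1 + 'X) ^+ b : {poly R})`_k.

(** Each factor 1 - X or 1 + X enlarges absolute values of coefficients at most as Pascal's rule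
    does. *)
Lemma krawtchouk_le_bin (R : realType) (a b k : nat) :
  `|krawtchouk R a b k| <= 'C(a + b, k)%:R.
Proof.
have step (p : {poly R}) (e : R) n : `|e| = 1 ->
    (forall i, `|p`_i| <= 'C(n, i)%:R) ->
    forall i, `|((1 + e *: 'X) * p)`_i| <= 'C(n.+1, i)%:R.
  move=> e1 hp i; rewrite mulrDl mul1r coefD -scalerAl coefZ coefXM.
  case: i => [|i] /=; first by rewrite mulr0 addr0 bin0; have := hp 0; rewrite bin0.
  rewrite binS natrD (le_trans (ler_normD _ _))// lerD//.
  by rewrite normrM e1 mul1r.
rewrite /krawtchouk; elim: a k => [|a IH] k.
  rewrite expr0 mul1r add0n; elim: b k => [|b IH] k.
    by rewrite expr0 coef1 bin0n; case: (k == _) => /=; rewrite ?normr1 ?normr0.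
    by rewrite exprS -{1}['X]scale1r; exact: (step _ _ _ (normr1 _) IH).
rewrite addSn exprS -mulrA -{1}scaleN1r.
exact: (step _ _ _ (normrN1 _) IH).
Qed.

(** Two draws without replacement from [n] points both avoid, or both hit, a fixed [k]-subset with
    probability at most that of draws with replacement, (1 - x)^2 or x^2. The factor [1 < k] removes
    the term that truncated subtraction would create. *)
Lemma bin_pair_recurrence (R : realType) (n k : nat) (x z : R) :
  (2 <= n)%N -> (k <= n)%N -> 0 <= z -> x = k%:R / n%:R ->
  'C(n - 2, k)%:R + z * ('C(n - 2, k - 2) * (1 < k))%N%:R
    <= ((1 - x) ^+ 2 + z * x ^+ 2) * 'C(n, k)%:R.
Proof.
move=> n2 kn z0 xE.
have n0 : (0 : R) < n%:R by rewrite ltr0n; lia.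
have n1 : (0 : R) < n%:R - 1 by rewrite subr_gt0 ltr1n.
have knR : k%:R <= n%:R :> R by rewrite ler_nat.
have k0 : 0 <= k%:R :> R by rewrite ler0n.
have c0 : 0 <= 'C(n, k)%:R :> R by rewrite ler0n.
have nx : n%:R * x = k%:R by rewrite xE mulrC divfK// gt_eqF.
have x0 : 0 <= x by rewrite xE divr_ge0.
have x1 : x <= 1 by rewrite xE ler_pdivrMr// mul1r.
rewrite mulrDl; apply: lerD.
  have e : (n * n.-1 * 'C(n - 2, k) = (n - k) * (n - k).-1 * 'C(n, k))%N.
    have := mul_bin_down n k; have := mul_bin_down n.-1 k.
    have -> : n.-1.-1 = (n - 2)%N by lia.
    have -> : (n.-1 - k = (n - k).-1)%N by lia.
    by move=> h1 h2; rewrite -mulnA h1 mulnCA h2; ring.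
  have := congr1 (fun m => m%:R : R) e; rewrite !natrM -subn1 natrB; last by lia.
  rewrite natrB// => {}e.
  have hk : (n - k).-1%:R * n%:R <= (n%:R - k%:R) * (n%:R - 1) :> R.
    by rewrite -natrB// -[1]/(1%:R) -natrB -?natrM ?ler_nat; nia.
  have p0 : 0 < n%:R * (n%:R - 1) * n%:R :> R by rewrite !mulr_gt0.
  rewrite -(ler_pM2l p0) mulrAC e.
  rewrite (_ : _ * (_ * _) = (n%:R - k%:R) * 'C(n,k)%:R * ((n%:R - k%:R) * (n%:R - 1))).
    by rewrite -!mulrA ler_wpM2l ?subr_ge0// mulrCA ler_wpM2l.
  by rewrite -nx; ring.
rewrite -mulrA ler_wpM2l//.
case: (ltnP 1 k) => k2; last by rewrite muln0 mulr_ge0// sqr_ge0.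
rewrite muln1.
have e : (n * n.-1 * 'C(n - 2, k - 2) = k * k.-1 * 'C(n, k))%N.
  have := mul_bin_diag n k.-1; have := mul_bin_diag n.-1 (k - 2).
  have -> : n.-1.-1 = (n - 2)%N by lia.
  have -> : ((k - 2).+1 = k.-1)%N by lia.
  have -> : (k.-1.+1 = k)%N by lia.
  by move=> h1 h2; rewrite -mulnA h1 mulnCA h2; ring.
have := congr1 (fun m => m%:R : R) e; rewrite !natrM -!subn1 natrB; last by lia.
rewrite natrB; last by lia.
move=> {}e.
have p0 : 0 < n%:R * (n%:R - 1) * n%:R :> R by rewrite !mulr_gt0.
rewrite -(ler_pM2l p0) mulrAC e.
rewrite (_ : n%:R * (n%:R - 1) * n%:R * (x ^+ 2 * 'C(n, k)%:R) = k%:R * 'C(n,k)%:R * (k%:R * (n%:R - 1))).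
  rewrite (_ : _ * n%:R = k%:R * 'C(n,k)%:R * ((k%:R - 1) * n%:R)); last by ring.
  by rewrite ler_wpM2l ?mulr_ge0//; nra.
by rewrite -nx; ring.
Qed.

Lemma expR_quarter_le (R : realType) : expR (1 / 4 : R) <= 4 / 3.
Proof.
have := expR_ge1Dx (- (1 / 4) : R); rewrite expRN => h.
have e0 := expR_gt0 (1 / 4 : R).
have := ler_wpM2r (ltW e0) h; rewrite mulVf ?gt_eqF//; lra.
Qed.

(* The hypothesis [3 * k <= 2 * m] keeps the ratio of [k] to the current degree at
   most 2/3 along the induction, where (1 - x)^2 + (4/3) x^2 <= 1 - x / 4. *)
Lemma coef_pairs_bound (R : realType) (p : {poly R}) (m i N k : nat) :
  (forall l, `|p`_l| <= 'C(m, l)%:R) ->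
  (m + 2 * i <= N)%N -> (3 * k <= 2 * m)%N ->
  `|((1 - 'X^2) ^+ i * p)`_k| <=
    expR (- (1 / 4) * (i%:R * k%:R / N%:R)) * 'C(m + 2 * i, k)%:R.
Proof.
move=> hp; elim: i k => [|i IH] k hN hk.
  by rewrite expr0 mul1r !mul0r mulr0 expR0 mul1r muln0 addn0.
have [->|k0] := posnP k.
  rewrite mulr0 mul0r mulr0 expR0 mul1r bin0 !coef0M.
  rewrite (_ : ((1 - 'X^2) ^+ i.+1)`_0 = 1); first by have := hp 0; rewrite bin0 mul1r.
  by rewrite -horner_coef0 !hornerE expr0n subr0 expr1n.
set n := (m + 2 * i.+1)%N.
have n2 : (2 <= n)%N by rewrite /n; lia.
have kn : (k <= n)%N by rewrite /n; lia.
have IHN : (m + 2 * i <= N)%N by lia.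
have N0 : (0 : R) < N%:R by rewrite ltr0n; lia.
have n0 : (0 : R) < n%:R by rewrite ltr0n; lia.
have eqn : (m + 2 * i = n - 2)%N by rewrite /n; lia.
pose E (l : R) : R := expR (- (1 / 4) * (i%:R * l / N%:R)).
rewrite exprS -mulrA mulrBl (mul1r (_ ^+ i * _)) coefB coefXnM.
have -> : (if (k < 2)%N then 0 else ((1 - 'X^2) ^+ i * p)`_(k - 2)) =
   ((1 < k)%N)%:R * ((1 - 'X^2) ^+ i * p)`_(k - 2).
  by rewrite ltnS; case: leqP => _; rewrite ?mul0r ?mul1r.
apply: le_trans (ler_normB _ _) _.
have h1 := IH k IHN hk.
have h2 := IH (k - 2)%N IHN _.
(* Replacing [k] by [k - 2] weakens the exponential by exp(i / (2N)), which is at most [z] because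
   2i <= N. *)
pose z := expR (1 / 4 : R).
have z1 : 0 <= z by exact: expR_ge0.
have h2' : `|(1 < k)%N%:R * ((1 - 'X^2) ^+ i * p)`_(k - 2)| <=
    E k%:R * (z * ('C(n - 2, k - 2) * (1 < k))%N%:R).
  case: (ltnP 1 k) => k2; last by rewrite mul0r normr0 muln0 mulr0 mulr0.
  rewrite mul1r muln1 mulrA; apply: le_trans (h2 _) _; first by lia.
  rewrite eqn ler_wpM2r// /E /z -expRD ler_expR natrB//.
  have hi : i%:R * 2 <= N%:R :> R by rewrite -natrM ler_nat; lia.
  have : i%:R * 2 / N%:R <= 1 :> R by rewrite ler_pdivrMr// mul1r.
  by lra.
apply: le_trans (lerD h1 h2') _.
rewrite eqn -/(E k%:R) -mulrDr.
apply: le_trans (ler_wpM2l (expR_ge0 _) (bin_pair_recurrence n2 kn z1 erefl)) _.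
rewrite mulrA ler_wpM2r//.
have -> : expR (- (1 / 4) * (i.+1%:R * k%:R / N%:R)) =
    E k%:R * expR (- (1 / 4) * (k%:R / N%:R)) :> R.
  by rewrite /E -expRD; congr expR; rewrite -addn1 natrD; ring.
rewrite ler_wpM2l ?expR_ge0//.
apply: le_trans (expR_ge1Dx (- (1 / 4) * (k%:R / N%:R))).
have z4 : z <= 4 / 3 by exact: expR_quarter_le.
have kx : k%:R / N%:R <= k%:R / n%:R :> R.
  by rewrite ler_wpM2l// lef_pV2 ?posrE// ler_nat.
have x23 : k%:R / n%:R <= 2 / 3 :> R.
  by rewrite ler_pdivrMr// mulrAC ler_pdivlMr// -!natrM ler_nat; lia.
have x0 : 0 <= k%:R / n%:R :> R by rewrite divr_ge0.
move: (k%:R / n%:R) (k%:R / N%:R) x23 x0 kx => x y x23 x0 kx.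
apply: (@le_trans _ _ ((1 - x) ^+ 2 + 4 / 3 * x ^+ 2)).
  by rewrite lerD2l ler_wpM2r// sqr_ge0.
by nra.
Qed.

(** From the [j] factors 1 - X and [n - j] factors 1 + X, [i] of each are paired into 1 - X^2. The
    bounds [8 * i <= n] and [2 * k <= n] yield 3k <= 2(n - 2i), as [coef_pairs_bound] requires of
    the unpaired part. *)
Lemma krawtchouk_bound (R : realType) (n j k i : nat) :
  (j <= n)%N -> (i <= j)%N -> (i <= n - j)%N -> (8 * i <= n)%N -> (2 * k <= n)%N ->
  `|krawtchouk R j (n - j) k| <=
    expR (- (1 / 4) * (i%:R * k%:R / n%:R)) * 'C(n, k)%:R.
Proof.
move=> jn ij inj i8 k2.
have pairsE : (1 - 'X^2) ^+ i * ((1 - 'X) ^+ (j - i) * (1 + 'X) ^+ (n - j - i)) =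
    (1 - 'X) ^+ j * (1 + 'X) ^+ (n - j) :> {poly R}.
  have -> : 1 - 'X^2 = (1 - 'X) * (1 + 'X) :> {poly R} by ring.
  rewrite exprMn mulrACA -!exprD.
  by congr (_ ^+ _ * _ ^+ _); lia.
have hp l : `|((1 - 'X) ^+ (j - i) * (1 + 'X) ^+ (n - j - i) : {poly R})`_l| <=
    'C(n - 2 * i, l)%:R.
  have := krawtchouk_le_bin R (j - i) (n - j - i) l.
  by have -> : (j - i + (n - j - i) = n - 2 * i)%N by lia.
have := @coef_pairs_bound R _ (n - 2 * i) i n k hp.
have -> : (n - 2 * i + 2 * i = n)%N by lia.
by rewrite pairsE; apply; lia.
Qed.

(** Supplies the number of pairs for [krawtchouk_bound]: as many as both kinds of factor allow,
    capped at n/8. The loss of 1 pays for rounding n/8 down. *)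
Lemma level_pairs (R : realType) (eps : R) (n j : nat) :
  0 < eps -> levels eps n j -> exists i : nat,
  [/\ (i <= j)%N, (j <= n)%N, (i <= n - j)%N, (8 * i <= n)%N &
    Num.min eps (1 / 8) * n%:R - 1 <= i%:R].
Proof.
move=> e0 /= /andP[h1 h2].
have n0 : 0 <= n%:R :> R by rewrite ler0n.
have jn : (j <= n)%N by rewrite -(ler_nat R); nra.
exists (minn (minn j (n - j)) (n %/ 8)).
split; [by lia|by []|by lia|by lia|].
have m1 : Num.min eps (1 / 8) * n%:R <= eps * n%:R by rewrite ler_wpM2r// ge_min lexx.
have m2 : Num.min eps (1 / 8) * n%:R <= 1 / 8 * n%:R.
  by rewrite ler_wpM2r// ge_min lexx orbT.
have b1 : Num.min eps (1 / 8) * n%:R - 1 <= j%:R by lra.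
have b2 : Num.min eps (1 / 8) * n%:R - 1 <= (n - j)%:R by rewrite natrB//; lra.
have b3 : Num.min eps (1 / 8) * n%:R - 1 <= (n %/ 8)%:R.
  have : (n <= 8 * (n %/ 8).+1)%N by lia.
  by rewrite -(ler_nat R) natrM -[(n %/ 8).+1%:R]natr1; lra.
by rewrite /minn; do 2?case: ifP.
Qed.

(** * Characters and small-set expansion *)

Definition bit_sign (R : pzRingType) (b : 'F_2) : R := (-1) ^+ (b == 1).

Lemma bit_signD (R : pzRingType) (a b : 'F_2) :
  bit_sign R (a + b) = bit_sign R a * bit_sign R b.
Proof.
rewrite /bit_sign -signr_addb; congr (_ ^+ nat_of_bool _).
by case: a => [[|[|a]]] // ?; case: b => [[|[|b]]] // ?.
Qed.

Lemma bit_signM (R : pzRingType) (a b : 'F_2) :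
  bit_sign R a * bit_sign R b = if a == b then 1 else -1.
Proof.
by case: a => [[|[|a]]] // ?; case: b => [[|[|b]]] // ?;
   rewrite /bit_sign /= ?expr0 ?expr1 ?mulrNN ?mul1r ?mulr1.
Qed.

Definition character (R : pzRingType) (n : nat) (S : {set 'I_n}) (x : cube n) : R :=
  \prod_(i in S) bit_sign R (x ord0 i).

(** On expanding the product, [S] is the set of coordinates where the term with [a] is chosen. The
    pairs (r, 1), (1, r) and (1, 1) for [(a, b)] serve the low energy, the high energy and
    orthogonality. *)
Lemma character_sum (R : comPzRingType) (n : nat) (a b : R) (x y : cube n) :
  \sum_(S : {set 'I_n}) a ^+ #|S| * b ^+ (n - #|S|) * character R S x * character R S y =
  \prod_i (a * bit_sign R (x ord0 i) * bit_sign R (y ord0 i) + b).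
Proof.
rewrite bigA_distr; apply: eq_bigr => S _.
rewrite (bigID (mem S)) /= -mulrA -mulrA mulrCA mulrC; congr (_ * _).
  rewrite -!big_split /= -prodr_const -big_split /=.
  by apply: eq_bigr => i ->; rewrite mulrA.
rewrite (eq_bigr (fun=> b)) => [|i /negbTE ->//].
rewrite prodr_const; congr (_ ^+ _).
have -> : (n - #|S| = #|~: S|)%N by have := cardsC S; rewrite card_ord; lia.
by apply: eq_card => i; rewrite inE.
Qed.

Definition slice (n : nat) (A : {set cube n.+1}) (b : 'F_2) : {set cube n} :=
  [set x | (row_mx (b%:M : 'rV_1) x : 'rV_(1 + n)) \in A]%SET.

Lemma sum_slice (R : nmodType) (n : nat) (A : {set cube n.+1}) (F : cube n.+1 -> R) :
  \sum_(x in A) F x =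
  \sum_(x in slice A 0) F (row_mx (0%:M : 'rV_1) x : 'rV_(1 + n)) +
  \sum_(x in slice A 1) F (row_mx (1%:M : 'rV_1) x : 'rV_(1 + n)).
Proof.
pose h (p : 'F_2 * cube n) : cube n.+1 := row_mx (p.1%:M : 'rV_1) p.2 : 'rV_(1 + n).
rewrite (reindex h) /=; last first.
  exists (fun x : 'rV_(1 + n) => ((lsubmx x) ord0 ord0, rsubmx x)) => [[b x] _|x _].
    by rewrite /h /= row_mxKl row_mxKr mxE eqxx mulr1n.
  by rewrite /h /= -mx11_scalar hsubmxK.
rewrite big_mkcond /= -(pair_big_dep xpredT (fun _ _ => true)
   (fun b x => if h (b, x) \in A then F (h (b, x)) else 0)) /=.
rewrite big_ord_recl big_ord1 /= -!big_mkcond /=.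
have -> : lift ord0 ord0 = 1 :> 'F_2 by exact: val_inj.
by congr (_ + _); apply: eq_bigl => x; rewrite inE.
Qed.

(** 2^n times the transition kernel of the noise operator with correlation [r]: a bit is kept with
    probability (1 + r)/2. *)
Definition noise (R : comPzRingType) (n : nat) (r : R) (x y : cube n) : R :=
  \prod_i (if x ord0 i == y ord0 i then 1 + r else 1 - r).

Lemma noise_row (R : comPzRingType) (n : nat) (r : R) (a b : 'F_2) (x y : cube n) :
  @noise R n.+1 r (row_mx (a%:M : 'rV_1) x : 'rV_(1 + n))
                  (row_mx (b%:M : 'rV_1) y : 'rV_(1 + n)) =
  (if a == b then 1 + r else 1 - r) * noise r x y.
Proof.
rewrite /noise (@big_split_ord _ _ _ 1 n) /= big_ord1.
congr (_ * _); first by rewrite !(@row_mxEl _ 1 1 n) !mxE !eqxx !mulr1n.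
by apply: eq_bigr => i _; rewrite !(@row_mxEr _ 1 1 n).
Qed.

Lemma card_slice (R : pzSemiRingType) (n : nat) (A : {set cube n.+1}) :
  #|A|%:R = #|slice A 0|%:R + #|slice A 1|%:R :> R.
Proof. by rewrite -!sumr_const; exact: (@sum_slice R n A (fun=> 1)). Qed.

(** Induction on the dimension: slicing along the first coordinate leaves exactly [two_point_ineq2]
    for the slice sizes. Two sets are needed, since slices with different first bits meet in the
    cross terms. *)
Lemma small_set_expansion (R : realType) (r d s : R) (n : nat) (A B : {set cube n}) :
  0 <= r < 1 -> d = (1 - r) / 4 -> s = (1 + d) / 2 ->
  \sum_(x in A) \sum_(y in B) noise r x y
    <= (2 `^ (1 - d)) ^+ n * (#|A|%:R * #|B|%:R) `^ s.
Proof.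
move=> r01 dE sE; case/andP: (r01) => r0 r1.
elim: n A B => [|n IH] A B.
  have cardle (X : {set cube 0}) : (#|X| <= 1)%N.
    by apply: leq_trans (max_card _) _; rewrite card_mx muln0 expn0.
  rewrite expr0 mul1r.
  under eq_bigr do under eq_bigr do rewrite /noise big_ord0.
  rewrite !sumr_const.
  have := cardle A; have := cardle B.
  case: #|A| => [|[]]//; case: #|B| => [|[]]// _ _;
    by rewrite ?mulr0n ?mul0rn ?powR_ge0// !mulr1n mulr1 powR1.
rewrite sum_slice.
under eq_bigr do rewrite sum_slice; under [X in _ + X]eq_bigr do rewrite sum_slice.
rewrite !big_split /=.
have noiseE (a b : 'F_2) X Y : \sum_(x in X) \sum_(y in Y)
    @noise R n.+1 r (row_mx (a%:M : 'rV_1) x : 'rV_(1 + n))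
                    (row_mx (b%:M : 'rV_1) y : 'rV_(1 + n)) =
    (if a == b then 1 + r else 1 - r) * \sum_(x in X) \sum_(y in Y) noise r x y.
  by rewrite mulr_sumr; apply: eq_bigr => x _; rewrite mulr_sumr;
     apply: eq_bigr => y _; rewrite noise_row.
rewrite !noiseE /=.
have p1 : 0 <= 1 + r by lra.
have p2 : 0 <= 1 - r by lra.
have c0 : 0 <= (2 `^ (1 - d)) ^+ n :> R by rewrite exprn_ge0// powR_ge0.
apply: le_trans (lerD (lerD (ler_wpM2l p1 (IH _ _)) (ler_wpM2l p2 (IH _ _)))
                      (lerD (ler_wpM2l p2 (IH _ _)) (ler_wpM2l p1 (IH _ _)))) _.
rewrite exprSr -mulrA !(card_slice R A) !(card_slice R B).
have := @two_point_ineq2 R r d s #|slice A 0|%:R #|slice A 1|%:R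
  #|slice B 0|%:R #|slice B 1|%:R r01 dE sE.
rewrite !ler0n => /(_ isT isT isT isT) /(ler_wpM2l c0); apply: le_trans.
move: (2 `^ _ ^+ n) ((#|slice A 0|%:R * #|slice B 0|%:R) `^ s)
  ((#|slice A 0|%:R * #|slice B 1|%:R) `^ s) ((#|slice A 1|%:R * #|slice B 0|%:R) `^ s)
  ((#|slice A 1|%:R * #|slice B 1|%:R) `^ s) => c u v w z.
by rewrite le_eqVlt; apply/orP; left; apply/eqP; ring.
Qed.

(** * Spherical character sums *)

Definition support_set (n : nat) (x : cube n) : {set 'I_n} :=
  [set i : 'I_n | x ord0 i == 1]%SET.

Definition set_point (n : nat) (S : {set 'I_n}) : cube n := \row_i (i \in S)%:R.

Lemma support_setK (n : nat) : cancel (@support_set n) (@set_point n).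
Proof.
move=> x; apply/rowP => i; rewrite mxE inE.
by case: (x ord0 i) => [[|[|b]]] // h; exact: val_inj.
Qed.

Lemma set_pointK (n : nat) : cancel (@set_point n) (@support_set n).
Proof. by move=> S; apply/setP => i; rewrite inE mxE; case: (i \in S). Qed.

Lemma character_support (R : comPzRingType) (n : nat) (S : {set 'I_n}) (x : cube n) :
  character R S x = (-1) ^+ #|S :&: support_set x|.
Proof.
rewrite /character (bigID (mem (support_set x))) /= [X in _ * X]big1 ?mulr1; last first.
  by move=> i /andP[_]; rewrite inE /bit_sign => /negbTE ->.
rewrite (eq_bigr (fun=> -1)) => [|i /andP[_]]; last first.
  by rewrite inE /bit_sign => ->.
by rewrite prodr_const; congr (_ ^+ _); apply: eq_card => i; rewrite finset.in_setI.
Qed.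

Lemma sum_sphere (R : nmodType) (n j : nat) (F : {set 'I_n} -> R) :
  \sum_(x in sphere n j) F (support_set x) = \sum_(S : {set 'I_n} | #|S| == j) F S.
Proof.
rewrite (reindex (@support_set n)) /=; last first.
  by exists (@set_point n) => ? _; [exact: support_setK | exact: set_pointK].
by apply: eq_bigl => x; rewrite inE.
Qed.

Lemma card_sphere (n j : nat) : #|sphere n j| = 'C(n, j).
Proof.
have := card_draws 'I_n j; rewrite card_ord => <-.
rewrite -sum1_card (sum_sphere j (fun=> 1%N)) -sum1_card.
by apply: eq_bigl => S; rewrite inE.
Qed.

Definition sphere_character_sum (R : pzRingType) (n j : nat) (S : {set 'I_n}) : R :=
  \sum_(x in sphere n j) character R S x.

Lemma sphere_character_sumE (R : comPzRingType) (n j : nat) (S : {set 'I_n}) :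
  sphere_character_sum R j S = \sum_(W : {set 'I_n} | #|W| == j) (-1) ^+ #|S :&: W|.
Proof.
by rewrite -sum_sphere; apply: eq_bigr => x _; rewrite character_support.
Qed.

(** Expand the product of 1 - X over [S] and 1 + X off [S]: choosing X on the set [W] contributes
    the sign (-1)^|S ∩ W| in degree |W|. *)
Lemma sphere_character_sum_krawtchouk (R : comNzRingType) (n j : nat) (S : {set 'I_n}) :
  sphere_character_sum R j S = krawtchouk R #|S| (n - #|S|) j.
Proof.
have -> : krawtchouk R #|S| (n - #|S|) j =
    (\prod_(i : 'I_n) (((-1) ^+ (i \in S))%:P * 'X + 1 : {poly R}))`_j.
  rewrite /krawtchouk; congr (nth 0 (polyseq _) j); rewrite (bigID (mem S)) /=.
  rewrite (eq_bigr (fun=> 1 - 'X)) => [|i ->]; last first.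
    by rewrite expr1 polyCN mulN1r addrC.
  rewrite [X in _ = _ * X](eq_bigr (fun=> 1 + 'X)) => [|i /negbTE ->]; last first.
    by rewrite expr0 mul1r addrC.
  rewrite !prodr_const; congr (_ * _ ^+ _).
  have -> : (n - #|S| = #|~: S|)%N by have := cardsC S; rewrite card_ord; lia.
  by apply: eq_card => i; rewrite inE.
rewrite bigA_distr coef_sum sphere_character_sumE big_mkcond /=.
apply: eq_bigr => W _.
rewrite (bigID (mem W)) /= [X in _ * X]big1 ?mulr1; last by move=> i /negbTE ->.
rewrite (eq_bigr (fun i => ((-1) ^+ (i \in S))%:P * 'X)) => [|i ->//].
rewrite big_split prodr_const /= -rmorph_prod coefCM coefXn eq_sym.
case: eqP => _; rewrite ?mulr0 ?mulr1//.
rewrite (bigID (mem S)) /= [X in _ = _ * X]big1 ?mulr1; last first.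
  by move=> i /andP[_ /negbTE ->].
rewrite (eq_bigr (fun=> -1)) => [|i /andP[_ ->]//].
by rewrite prodr_const; congr (_ ^+ _); apply: eq_card => i; rewrite finset.setIC finset.in_setI.
Qed.

(** Both sides sum (-1)^|S ∩ W| over all sets with |S| = k and |W| = j, in the two orders of
    summation. *)
Lemma krawtchouk_reciprocity (R : comNzRingType) (n j k : nat) :
  'C(n, k)%:R * krawtchouk R k (n - k) j = 'C(n, j)%:R * krawtchouk R j (n - j) k.
Proof.
have sumE (a b : nat) : \sum_(S : {set 'I_n} | #|S| == a)
    \sum_(W : {set 'I_n} | #|W| == b) (-1) ^+ #|S :&: W| =
    'C(n, a)%:R * krawtchouk R a (n - a) b.
  under eq_bigr => S /eqP Sa do
    rewrite -sphere_character_sumE sphere_character_sum_krawtchouk Sa.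
  have := card_draws 'I_n a; rewrite card_ord => <-.
  by rewrite mulr_natl -sumr_const; apply: eq_bigl => S; rewrite inE.
rewrite -!sumE exchange_big; apply: eq_bigr => S _; apply: eq_bigr => W _.
by rewrite finset.setIC.
Qed.

(** A set [W] of size [j] splits into its parts inside and outside [S], so the two signs multiply to
    (-1)^j. This reduces large [S] to sets of size at most n/2. *)
Lemma sphere_character_sumC (R : comNzRingType) (n j : nat) (S : {set 'I_n}) :
  sphere_character_sum R j (~: S) = (-1) ^+ j * sphere_character_sum R j S.
Proof.
rewrite !sphere_character_sumE mulr_sumr; apply: eq_bigr => W /eqP <-.
rewrite -(cardsID S W) finset.setDE [~: S :&: W]finset.setIC [S :&: W]finset.setIC.
by rewrite exprD mulrAC -expr2 -exprM mulnC exprM sqrrN !expr1n mul1r.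
Qed.

Lemma sphere_character_sum_bound (R : realType) (eps r : R) (n j : nat) (S : {set 'I_n}) :
  0 < eps -> levels eps n j -> r = expR (- (1 / 4) * Num.min eps (1 / 8)) ->
  `|sphere_character_sum R j S| <=
    2 * 'C(n, j)%:R * (r ^+ #|S| + r ^+ (n - #|S|)).
Proof.
move=> e0 lv rE.
have r0 : 0 <= r by rewrite rE expR_ge0.
have [i [ij jn inj i8 hi]] := level_pairs e0 lv.
have small (T : {set 'I_n}) : (2 * #|T| <= n)%N ->
    `|sphere_character_sum R j T| <= 2 * 'C(n, j)%:R * r ^+ #|T|.
  move=> T2; set k := #|T| in T2 *.
  have kn : (k <= n)%N by lia.
  have ck : 0 < 'C(n, k)%:R :> R by rewrite ltr0n bin_gt0.
  (* Reciprocity exchanges the roles of [j] and [k], so that the evaluation point becomes [j], which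
     is far from 0 and [n] and leaves many factors to pair. *)
  rewrite sphere_character_sum_krawtchouk -(ler_pM2l ck) -[X in X * `|_|]ger0_norm ?ler0n//.
  rewrite -normrM krawtchouk_reciprocity normrM ger0_norm ?ler0n// -/k.
  apply: le_trans (ler_wpM2l (ler0n _ _) (krawtchouk_bound R jn ij inj i8 T2)) _.
  rewrite [X in _ <= X](_ : _ = 'C(n, j)%:R * (2 * r ^+ k * 'C(n, k)%:R)); last by ring.
  rewrite ler_wpM2l// ler_wpM2r//.
  have [n0|n0] := posnP n.
    have -> : k = 0%N by lia.
    by rewrite !mulr0 mul0r mulr0 expR0 expr0; lra.
  have n0' : 0 < n%:R :> R by rewrite ltr0n.
  have hx : k%:R / n%:R <= 1 / 2 :> R.
    by rewrite ler_pdivrMr// mulrAC ler_pdivlMr// mulrC mul1r -natrM ler_nat.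
  have x0 : 0 <= k%:R / n%:R :> R by rewrite divr_ge0.
  have {}hi := ler_wpM2r x0 hi.
  (* The loss of 1 in the number of pairs costs a factor exp(k / (4n)), which the constant 2
     absorbs. *)
  have e2 : expR (1 / 4) <= 2 :> R by apply: le_trans (expR_quarter_le R) _; lra.
  apply: le_trans (ler_wpM2r (exprn_ge0 k r0) e2).
  rewrite rE -expRM_natl -expRD ler_expR.
  have hk : Num.min eps (1 / 8) * n%:R * (k%:R / n%:R) = k%:R * Num.min eps (1 / 8).
    by field; rewrite gt_eqF.
  rewrite -mulrA; move: hi hx; rewrite mulrBl hk.
  by move: (Num.min _ _) (k%:R / n%:R) => m x; lra.
have b0 : 0 <= 2 * 'C(n, j)%:R :> R by rewrite mulr_ge0.
have cS : (#|~: S| = n - #|S|)%N by have := cardsC S; rewrite card_ord; lia.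
rewrite mulrDr.
have [S2|S2] := leqP (2 * #|S|) n.
  by apply: le_trans (small _ S2) _; rewrite lerDl mulr_ge0// exprn_ge0.
have := small (~: S); rewrite cS sphere_character_sumC normrM normrX normrN1 expr1n mul1r.
move=> h; apply: le_trans (h _) _; first by lia.
by rewrite lerDr mulr_ge0// exprn_ge0.
Qed.

(** * Counting pairs with sum on a sphere *)

Definition fourier_coef (R : pzRingType) (n : nat) (A : {set cube n}) (S : {set 'I_n}) : R :=
  \sum_(x in A) character R S x.

Lemma fourier_coef_sqr (R : comPzRingType) (n : nat) (A : {set cube n}) (S : {set 'I_n}) :
  fourier_coef R A S ^+ 2 =
  \sum_(x in A) \sum_(y in A) character R S x * character R S y.
Proof. by rewrite expr2 /fourier_coef big_distrlr. Qed.

Lemma sum_fourier_coef_sqr (R : comPzRingType) (n : nat) (a b : R) (A : {set cube n}) :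
  \sum_(S : {set 'I_n}) a ^+ #|S| * b ^+ (n - #|S|) * fourier_coef R A S ^+ 2 =
  \sum_(x in A) \sum_(y in A) \prod_i (a * bit_sign R (x ord0 i) * bit_sign R (y ord0 i) + b).
Proof.
under [RHS]eq_bigr do under eq_bigr do rewrite -character_sum.
under [RHS]eq_bigr do rewrite exchange_big /=.
rewrite exchange_big /=; apply: eq_bigr => S _.
rewrite fourier_coef_sqr mulr_sumr; apply: eq_bigr => x _.
by rewrite mulr_sumr; apply: eq_bigr => y _; rewrite mulrA.
Qed.

Lemma fourier_energy_low (R : comPzRingType) (n : nat) (r : R) (A : {set cube n}) :
  \sum_(S : {set 'I_n}) r ^+ #|S| * fourier_coef R A S ^+ 2 =
  \sum_(x in A) \sum_(y in A) noise r x y.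
Proof.
have := sum_fourier_coef_sqr r 1 A.
under eq_bigr do rewrite expr1n mulr1.
move=> ->; apply: eq_bigr => x _; apply: eq_bigr => y _; apply: eq_bigr => i _.
by rewrite -mulrA bit_signM; case: eqP => _; rewrite ?mulr1 ?mulrN1 addrC.
Qed.

(** The kernel of this sum has the factor r - 1 instead of 1 - r where the bits differ, so its
    absolute value is the noise kernel. *)
Lemma fourier_energy_high (R : realType) (n : nat) (r : R) (A : {set cube n}) :
  0 <= r < 1 ->
  \sum_(S : {set 'I_n}) r ^+ (n - #|S|) * fourier_coef R A S ^+ 2 <=
  \sum_(x in A) \sum_(y in A) noise r x y.
Proof.
move=> /andP[r0 r1].
have := sum_fourier_coef_sqr 1 r A.
under eq_bigr do rewrite expr1n mul1r.
move=> ->; apply: ler_sum => x _; apply: ler_sum => y _.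
apply: le_trans (ler_norm _) _; rewrite normr_prod.
apply: ler_prod => i _; rewrite normr_ge0 /= -mulrA mul1r bit_signM.
case: eqP => _; first by rewrite ger0_norm//; lra.
by rewrite ler0_norm; lra.
Qed.

Lemma characterD (R : comPzRingType) (n : nat) (S : {set 'I_n}) (x y : cube n) :
  character R S (x + y) = character R S x * character R S y.
Proof.
by rewrite /character -big_split; apply: eq_bigr => i _; rewrite mxE bit_signD.
Qed.

Lemma character_orthogonality (R : comPzRingType) (n : nat) (x y : cube n) :
  \sum_(S : {set 'I_n}) character R S x * character R S y = (2 ^+ n) *+ (x == y).
Proof.
rewrite (eq_bigr (fun S : {set 'I_n} => 1 ^+ #|S| * 1 ^+ (n - #|S|) *
  character R S x * character R S y)) => [|S _]; last by rewrite !expr1n !mul1r.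
rewrite character_sum; case: eqVneq => [->|xy].
  under eq_bigr do rewrite mul1r bit_signM eqxx.
  by rewrite prodr_const card_ord.
have [i xyi] : exists i, x ord0 i != y ord0 i.
  apply/existsP; apply: contraNT xy; rewrite negb_exists => /forallP h.
  by apply/eqP/rowP => i; apply/eqP; rewrite -[_ == _]negbK.
by rewrite (bigD1 i)//= mul1r bit_signM (negbTE xyi) addNr mul0r.
Qed.

Definition sphere_pair_count (R : pzSemiRingType) (n : nat) (A : {set cube n}) (j : nat) : R :=
  \sum_(x in A) \sum_(y in A) (x + y \in sphere n j)%:R.

(** Fourier inversion of the indicator of the sphere at [x + y]: the character splits there, and
    summing over [A] twice squares the coefficient. *)
Lemma sphere_pair_count_fourier (R : comPzRingType) (n : nat) (A : {set cube n}) (j : nat) :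
  2 ^+ n * sphere_pair_count R A j =
  \sum_(S : {set 'I_n}) sphere_character_sum R j S * fourier_coef R A S ^+ 2.
Proof.
have pairE (x y : cube n) : 2 ^+ n * (x + y \in sphere n j)%:R =
    \sum_(S : {set 'I_n}) sphere_character_sum R j S * (character R S x * character R S y).
  under eq_bigr do rewrite -characterD mulr_suml.
  rewrite exchange_big /=.
  under eq_bigr do rewrite character_orthogonality.
  case: (boolP (x + y \in sphere n j)) => xy /=.
    rewrite (bigD1 (x + y))//= eqxx big1 ?addr0 ?mulr1// => z /andP[_ /negbTE ->].
    by rewrite mulr0n.
  rewrite mulr0 big1// => z zS; case: eqP => [zE|]; last by rewrite mulr0n.
  by rewrite -zE zS in xy.
rewrite /sphere_pair_count mulr_sumr.
under eq_bigr do rewrite mulr_sumr.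
under eq_bigr do under eq_bigr do rewrite pairE.
under eq_bigr do rewrite exchange_big /=.
rewrite exchange_big /=; apply: eq_bigr => S _.
under eq_bigr do rewrite -mulr_sumr.
by rewrite -mulr_sumr fourier_coef_sqr.
Qed.

Lemma sphere_pair_bound (R : realType) (eps r d : R) (n j : nat) (A : {set cube n}) :
  0 < eps -> levels eps n j -> r = expR (- (1 / 4) * Num.min eps (1 / 8)) ->
  d = (1 - r) / 4 ->
  sphere_pair_count R A j <=
    4 * 'C(n, j)%:R * #|A|%:R * (#|A|%:R / 2 ^+ n) `^ d.
Proof.
move=> e0 lv rE dE.
have r01 : 0 <= r < 1.
  rewrite rE expR_ge0 /= expR_lt1.
  have : 0 < Num.min eps (1 / 8) by rewrite lt_min e0; lra.
  by lra.
have u0 : 0 < 2 ^+ n :> R by rewrite exprn_gt0.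
rewrite -(ler_pM2l u0) sphere_pair_count_fourier.
have c0 : 0 <= 2 * 'C(n, j)%:R :> R by rewrite mulr_ge0.
apply: (@le_trans _ _ (2 * 'C(n, j)%:R *
   (\sum_(S : {set 'I_n}) r ^+ #|S| * fourier_coef R A S ^+ 2 +
    \sum_(S : {set 'I_n}) r ^+ (n - #|S|) * fourier_coef R A S ^+ 2))).
  rewrite -big_split /= mulr_sumr; apply: ler_sum => S _.
  rewrite -mulrDl mulrA ler_wpM2r ?sqr_ge0//.
  exact: le_trans (ler_norm _) (sphere_character_sum_bound S e0 lv rE).
have energy := small_set_expansion A A r01 dE erefl.
have h1 := fourier_energy_low r A.
have h2 := fourier_energy_high A r01.
apply: (@le_trans _ _ (2 * 'C(n, j)%:R *
   (2 * ((2 `^ (1 - d)) ^+ n * (#|A|%:R * #|A|%:R) `^ ((1 + d) / 2))))).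
  by rewrite ler_wpM2l//; lra.
set t : R := #|A|%:R / 2 ^+ n.
have AE : #|A|%:R = 2 ^+ n * t :> R by rewrite /t mulrC divfK// gt_eqF.
have t0 : 0 <= t by rewrite /t divr_ge0// ltW.
have d0 : 0 < d by case/andP: r01 => r0 r1; lra.
have -> : (#|A|%:R * #|A|%:R) `^ ((1 + d) / 2) = (2 ^+ n) `^ (1 + d) * (t * t `^ d).
  rewrite -expr2 -(@powR_mulrn _ _ 2 (ler0n _ _)) -powRrM.
  rewrite (_ : 2%:R * ((1 + d) / 2) = 1 + d); last by field.
  rewrite AE powRM ?(ltW u0)//; congr (_ * _).
  rewrite powRD ?powRr1//; apply/implyP => /eqP; lra.
(* The powers of 2^n with exponents 1 - d and 1 + d combine to 4^n: one 2^n matches the factor on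
   the left, the other turns the density [t] into the size of [A]. *)
rewrite -(powR_mulrn n (powR_ge0 _ _)) powRAC powR_mulrn ?ler0n//.
rewrite [(2 ^+ n) `^ (1 - d) * _]mulrA -powRD; last by apply/implyP => /eqP; lra.
rewrite (_ : 1 - d + (1 + d) = 2%:R); last by ring.
rewrite powR_mulrn ?(ltW u0)// AE le_eqVlt; apply/orP; left; apply/eqP.
by ring.
Qed.

(** * The ratio and the probability as one pair count, and the conclusion *)

Lemma sphere_ratioE (R : realType) (n j : nat) (A : {set cube n}) :
  sphere_ratio R A j = sphere_pair_count R A j / ('C(n, j)%:R * #|A|%:R).
Proof.
have u0 : 2 ^+ n != 0 :> R by rewrite expf_neq0.
rewrite /sphere_ratio /inner mulVKf// card_sphere; congr (_ / _).
under eq_bigr do rewrite /convolution mulr_suml.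
rewrite exchange_big /= /sphere_pair_count [RHS]exchange_big /=.
rewrite [RHS]big_mkcond /=; apply: eq_bigr => y _.
(* Translating by [y] turns the convolution into a sum over pairs of [A] whose sum lies on the
   sphere. *)
rewrite (reindex_inj (addIr y)) /= /indicator.
case: (y \in A) => /=; last by rewrite big1// => x _; rewrite mulr0 mul0r.
rewrite [RHS]big_mkcond /=; apply: eq_bigr => x _.
by rewrite addrK mulr1; case: (x \in A); rewrite ?mul1r ?mul0r.
Qed.

(** In characteristic 2 the map from [(x, y)] to [(x, x + y)] is an involution, so it matches the
    favourable outcomes with the pairs of [A] whose sum lies on the sphere. *)
Lemma finite_uniform_prob_pairE (R : realType) (n j : nat) (A : {set cube n}) :
  finite_uniform_prob R (finset.setX A (sphere n j)) (fun w => w.1 + w.2 \in A) =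
  sphere_pair_count R A j / ('C(n, j)%:R * #|A|%:R).
Proof.
rewrite /finite_uniform_prob cardsX card_sphere natrM [#|A|%:R * _]mulrC; congr (_ / _).
have addxx (x y : cube n) : x + (x + y) = y.
  rewrite addrA -[X in X + y]mulr2n -scaler_nat.
  by rewrite (_ : 2%:R = 0 :> 'F_2) ?scale0r ?add0r//; exact: val_inj.
rewrite -sumr_const big_mkcond /= (eq_bigr (fun p : cube n * cube n =>
  if (p.1 \in A) then (if p.1 + p.2 \in A then (p.2 \in sphere n j)%:R else 0) else 0 : R)); last first.
  move=> [x y] _; rewrite !inE /=.
  by case: (x \in A) => //=; case: (x + y \in A); rewrite ?andbF//= andbT; case: eqP.
rewrite -(pair_big_dep xpredT (fun _ _ => true) (fun x y : cube n =>
  if x \in A then (if x + y \in A then (y \in sphere n j)%:R else 0) else 0 : R)) /=.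
rewrite [RHS]big_mkcond /=; apply: eq_bigr => x _.
case: ifP => xA; last by rewrite big1.
rewrite (reindex_inj (addrI x)) /= [RHS]big_mkcond /=.
by apply: eq_bigr => y _; rewrite addxx.
Qed.

Theorem corollary1p3 (R : realType) (eps : R) (heps : 0 < eps < 1) :
  exists C1 C2 : R, [/\ 0 < C1, 0 < C2 &
    forall (n : nat) (A : {set cube n}) (lambda : R),
      (1 <= n)%N -> A != finset.set0 -> 0 < lambda ->
      ((lambda%:E <= ereal_sup [set (sphere_ratio R A j)%:E | j in levels eps n]%classic)%E ->
         C1 * lambda `^ C2 * 2 ^+ n <= #|A|%:R)
      /\
      (forall j : nat, levels eps n j ->
         lambda <= finite_uniform_prob R (finset.setX A (sphere n j))
                     (fun w => w.1 + w.2 \in A) ->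
         C1 * lambda `^ C2 * 2 ^+ n <= #|A|%:R)].
Proof.
case/andP: heps => e0 e1.
pose r := expR (- (1 / 4) * Num.min eps (1 / 8)).
pose d := (1 - r) / 4.
have r1 : r < 1.
  rewrite /r expR_lt1.
  have : 0 < Num.min eps (1 / 8) by rewrite lt_min e0; lra.
  by lra.
have d0 : 0 < d by rewrite /d; lra.
have q0 : 0 < 4 `^ d^-1 :> R by rewrite powR_gt0.
(* Both constants come from solving lambda <= 4 t^d for the density [t]. *)
exists (4 `^ d^-1)^-1, d^-1; split; rewrite ?invr_gt0// => n A lambda n1 A0 l0.
have u0 : 0 < 2 ^+ n :> R by rewrite exprn_gt0.
have a0 : 0 < #|A|%:R :> R by rewrite ltr0n card_gt0.
set t : R := #|A|%:R / 2 ^+ n.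
have t0 : 0 <= t by rewrite /t divr_ge0// ltW.
have bound j : levels eps n j ->
    sphere_pair_count R A j / ('C(n, j)%:R * #|A|%:R) <= 4 * t `^ d.
  move=> lv; have [i [_ jn _ _ _]] := level_pairs e0 lv.
  have b0 : 0 < 'C(n, j)%:R :> R by rewrite ltr0n bin_gt0.
  rewrite ler_pdivrMr ?mulr_gt0//.
  apply: le_trans (sphere_pair_bound A e0 lv erefl erefl) _.
  by rewrite le_eqVlt; apply/orP; left; apply/eqP; rewrite -/t; ring.
have conclude : lambda <= 4 * t `^ d ->
    (4 `^ d^-1)^-1 * lambda `^ d^-1 * 2 ^+ n <= #|A|%:R.
  move=> h; rewrite -ler_pdivlMr// -/t mulrC ler_pdivrMr//.
  have := @ge0_ler_powR R d^-1 _ lambda (4 * t `^ d) _ _ h.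
  rewrite !nnegrE invr_ge0 (ltW d0) (ltW l0) mulr_ge0 ?powR_ge0// => /(_ isT isT isT).
  by rewrite powRM ?powR_ge0// -powRrM mulfV ?gt_eqF// powRr1// mulrC.
split => [h|j lv h]; apply: conclude.
  (* The termwise bound passes to the supremum; with no level in the interval the supremum is minus
     infinity and the bound is trivial. *)
  rewrite -lee_fin; apply: le_trans h _; apply: ge_ereal_sup => _ [j lv <-].
  by rewrite lee_fin sphere_ratioE; exact: bound.
by apply: le_trans h _; rewrite finite_uniform_prob_pairE; exact: bound.
Qed.
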